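(* Let $A\neq 0$ be a square matrix with Kronecker sum structure, let $b$ be a vector of compatible size, and let $p\ge 0$ be an integer. Let $$I_{p+1}=\varphi_{p+1}(A)b=\int_0^1\frac{\theta^{p}}{p!}e^{(1-\theta)A}b\,d\theta ,\qquad \hat I_{p+1}=\sum_{i=1}^{n+1}w_i\frac{x_i^{p}}{p!}e^{(1-x_i)A}b,$$ where $\{(w_i,x_i)\}_{i=1}^{n+1}$ are the weights and nodes on $[0,1]$ of either the $(n+1)$-point Clenshaw–Curtis rule or the $(n+1)$-point Gauss–Legendre rule. (i) (Clenshaw–Curtis) If $n\ge\max\left(4,\left\lceil\frac{1+\sqrt2}{2}\lVert A\rVert_\infty+p\right\rceil\right)$ and $n$ is even, then $$\lVert I_{p+1}-\hat I_{p+1}\rVert_\infty\le\frac{\lVert b\rVert_\infty}{2^{p+1}p!}\left(\frac{n-p}{\frac e2\lVert A\rVert_\infty}\right)^{-(n-p)}.$$ If instead $n$ is odd, the bound still holds with $n$ replaced by $n-1$ on the right-hand side. (ii) (Gaussian quadrature) If $n\ge\max\left(2,\left\lceil\frac{1+\sqrt2}{4}\lVert A\rVert_\infty+\frac p2\right\rceil\right)$, then $$\lVert I_{p+1}-\hat I_{p+1}\rVert_\infty\le\frac{\lVert b\rVert_\infty}{2^{p+1}p!}\left(\frac{2n-p}{\frac e2\lVert A\rVert_\infty}\right)^{-(2n-p)}.$$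
   Context: For a square matrix $A$ and an integer $q\ge1$, $\varphi_q(A)=\int_0^1 e^{(1-\theta)A}\frac{\theta^{q-1}}{(q-1)!}\,d\theta$. The convention $0^0=1$ is used. $\lVert\cdot\rVert_\infty$ is the maximum norm for vectors and the induced operator norm (maximum absolute row sum) for matrices; in the bounds, $e$ is Euler's number. Kronecker sum structure means $A=A^x\otimes I^y+I^x\otimes A^y$ (2D) or $A=A^x\otimes I^y\otimes I^z+I^x\otimes A^y\otimes I^z+I^x\otimes I^y\otimes A^z$ (3D), where $A^x,A^y,A^z$ are square matrices, $I^x,I^y,I^z$ are identity matrices of the matching sizes, and $\otimes$ is the Kronecker product. The $(n+1)$-point Gauss–Legendre rule on $[-1,1]$ is the interpolatory rule whose nodes are the zeros of the Legendre polynomial of degree $n+1$. The $(n+1)$-point Clenshaw–Curtis rule on $[-1,1]$ is the interpolatory rule with nodes $\cos(k\pi/n)$, $k=0,\dots,n$. The rules on $[0,1]$ are obtained by the affine map $\theta=(s+1)/2$, $s\in[-1,1]$, with the weights halved. All computations are in exact arithmetic. *)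

(* Defs.v *)
From HB Require Import structures.
From mathcomp Require Export all_boot all_order all_algebra.
From mathcomp Require Export complex mxtens.
From mathcomp Require Export all_classical all_reals all_analysis.
Set Implicit Arguments.
Unset Strict Implicit.
Unset Printing Implicit Defensive.
Import Order.TTheory GRing.Theory Num.Theory.
Import numFieldNormedType.Exports.
Local Open Scope classical_set_scope.
Local Open Scope ring_scope.
Local Open Scope complex_scope.

(* Square matrices are taken over the complex numbers R[i]; real matrices are
   those with entries of the form x%:C. *)

(* The maximum absolute row sum. On a column vector every row sum has a single
   term, so there it is the maximum norm. *)
Definition norm_inf (R : realType) (m n : nat) (A : 'M[R[i]]_(m, n)) : R :=
  \big[Num.max/0]_(i < m) \sum_(j < n) ComplexField.Normc.normc (A i j).

(* The entrywise limit of the exponential series, real and imaginary parts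
   taken separately. *)
Definition expm_partial (R : realType) (N : nat) (A : 'M[R[i]]_N) (m : nat) :
    'M[R[i]]_N :=
  \sum_(k < m) (k`!%:R)^-1 *: A ^+ k.

Definition expm (R : realType) (N : nat) (A : 'M[R[i]]_N) : 'M[R[i]]_N :=
  \matrix_(i, j)
    (limn (fun m => complex.Re (expm_partial A m i j)) +i*
     limn (fun m => complex.Im (expm_partial A m i j))).

Definition integral01 (R : realType) (f : R -> R[i]) : R[i] :=
  (\int[lebesgue_measure]_(t in `[0, 1]) complex.Re (f t)) +i*
  (\int[lebesgue_measure]_(t in `[0, 1]) complex.Im (f t)).

(* Meaningful for 1 <= q only. *)
Definition phi (R : realType) (N : nat) (q : nat) (A : 'M[R[i]]_N) :
    'M[R[i]]_N :=
  \matrix_(i, j)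
    integral01 (fun t : R =>
      expm ((1 - t)%:C *: A) i j * (t ^+ q.-1 / (q.-1)`!%:R)%:C).

Inductive kronecker_sum (R : realType) : forall N : nat, 'M[R[i]]_N -> Prop :=
| KroneckerSum2 (nx ny : nat) (Ax : 'M[R[i]]_nx) (Ay : 'M[R[i]]_ny) :
    kronecker_sum (Ax *t (1%:M : 'M[R[i]]_ny) + (1%:M : 'M[R[i]]_nx) *t Ay)
| KroneckerSum3 (nx ny nz : nat) (Ax : 'M[R[i]]_nx) (Ay : 'M[R[i]]_ny)
    (Az : 'M[R[i]]_nz) :
    kronecker_sum (Ax *t (1%:M : 'M[R[i]]_ny) *t (1%:M : 'M[R[i]]_nz)
                   + (1%:M : 'M[R[i]]_nx) *t Ay *t (1%:M : 'M[R[i]]_nz)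
                   + (1%:M : 'M[R[i]]_nx) *t (1%:M : 'M[R[i]]_ny) *t Az).

(* Rodrigues' formula. *)
Definition legendre (R : realType) (n : nat) : {poly R} :=
  (2 ^+ n * n`!%:R)^-1 *: (('X ^+ 2 - 1) ^+ n)^`(n).

Definition gauss_legendre_nodes (R : realType) (n : nat)
    (s : 'I_n.+1 -> R) : Prop :=
  injective s /\
  (forall x : R, root (legendre R n.+1) x <-> exists i, s i = x).

Definition clenshaw_curtis_nodes (R : realType) (n : nat) (k : 'I_n.+1) : R :=
  cos (k%:R * pi / n%:R).

Definition lagrange_basis (R : realType) (n : nat) (s : 'I_n.+1 -> R)
    (i : 'I_n.+1) : {poly R} :=
  \prod_(j < n.+1 | j != i) ((s i - s j)^-1 *: ('X - (s j)%:P)).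

(* The interpolatory rule on [-1, 1] integrates the Lagrange interpolant at the
   nodes s, so its weights are the integrals of the Lagrange basis. *)
Definition interpolatory_weight (R : realType) (n : nat) (s : 'I_n.+1 -> R)
    (i : 'I_n.+1) : R :=
  \int[lebesgue_measure]_(x in `[-1, 1]) (lagrange_basis s i).[x].

Definition node01 (R : realType) (n : nat) (s : 'I_n.+1 -> R)
    (i : 'I_n.+1) : R := (s i + 1) / 2.

Definition weight01 (R : realType) (n : nat) (s : 'I_n.+1 -> R)
    (i : 'I_n.+1) : R := interpolatory_weight s i / 2.

Definition phi_quadrature (R : realType) (N n : nat) (s : 'I_n.+1 -> R)
    (p : nat) (A : 'M[R[i]]_N) (b : 'cV[R[i]]_N) : 'cV[R[i]]_N :=
  \sum_(i < n.+1)
    (weight01 s i * (node01 s i ^+ p / p`!%:R))%:C *: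
      (expm ((1 - node01 s i)%:C *: A) *m b).

(* The exponent is an integer power; 0 ^ 0 = 1. *)
Definition quadrature_bound (R : realType) (normA normb : R) (p m : nat) : R :=
  normb / (2 ^+ p.+1 * p`!%:R) *
  ((m%:R - p%:R) / (expR 1 / 2 * normA)) ^ (- (m%:Z - p%:Z)).

(* Main.v *)
Require Import Defs.
From mathcomp Require Import ring lra zify.
From mathcomp Require Import measurable_realfun polyorder cauchyreals.
Set Implicit Arguments.
Unset Strict Implicit.
Unset Printing Implicit Defensive.
Import Order.TTheory GRing.Theory Num.Theory.
Import numFieldNormedType.Exports.
Local Open Scope classical_set_scope.
Local Open Scope ring_scope.
Local Open Scope complex_scope.

(** Why the bound holds. Expand the matrix exponential: the error of the rule on
    [theta^p / p! * exp((1 - theta) A) b] is the limit of the finite sums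
    [sum_k e_k A^k b], where [e_k] is the error of the rule on the scalar
    polynomial [(1 - theta)^k theta^p / (k! p!)]. So it suffices to estimate
    [e_k] by something whose product with [|A|^k] sums to an exponential, and
    this is a matter of Chebyshev polynomials.

    Let [E] be the error functional on [[-1, 1]] and let [m] be [n]
    (Clenshaw-Curtis, [n] even), [n - 1] ([n] odd) or [2n] (Gauss-Legendre).
    Then [E T_j = 0] for [j <= m + 1], and [|E T_j| <= 2 + 2/35 = 72/35] for the
    other [j], which are at least 6 (lemmas [clenshaw_curtis_chebT_le] and
    [gauss_chebT_le]). Fix [rho >= 1] and put [w_j = (rho^j + rho^-j) / 2], the
    value of [T_j] at the real point [h = (rho + 1/rho) / 2] of the Bernstein
    ellipse. The two facts combine into
    [|E T_j| <= (144/35) rho^-(m+2) w_j]. A bound of the form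
    [|E (c T_j)| <= B w_j] for all [j] survives, with [B] multiplied by
    [sigma = (1 + h) / 2], when [c] is multiplied by [(1 + x)/2] or [(1 - x)/2],
    because [x T_j = (T_{j+1} + T_{j-1}) / 2] and the [w_j] satisfy the same
    recurrence at [h] (lemma [functional_step]). Taking [j = 0] after [k + p]
    factors bounds [e_k] by a multiple of [rho^-(m+2) sigma^(k+p)]. This is the
    estimate that Cauchy integrals over the ellipse would give, obtained here
    without complex analysis and for each [rho] at once.

    Summing over [k] gives, for every [rho >= 1], the bound
    [(72/35) rho^-(m+2) sigma^p / p! * exp(sigma |A|) |b|]
    (lemma [phi_quadrature_error_cheb]). The last step is the choice of [rho].
    With [r = m - p] and [rho = 2 r / |A|] the hypothesis on [n] says precisely
    that [rho >= 1 + sqrt 2]; this is the condition under which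
    [sigma <= rho / 2], and it also makes [144/35 <= rho^2]. Substituting, the
    bound becomes the stated one. For odd [n] the hypothesis only gives
    [|A| <= 2 (r + 1) / (1 + sqrt 2)]; then [rho = 2 (r + 1) / |A|] is used, and
    the loss of a factor [e (r / (r + 1))^r] is paid for by the slack in
    [144/35 <= rho^2]. If moreover [r = 0], then [p >= 4] and [rho = 4] is a
    suitable choice. *)

(** * Integrals of polynomials *)

Definition poly_int (R : realType) (a b : R) (p : {poly R}) : R :=
  \int[lebesgue_measure]_(x in `[a, b]) p.[x].

Lemma integrable_horner (R : realType) (a b : R) (p : {poly R}) :
  (@lebesgue_measure R).-integrable `[a, b] (EFin \o horner p).
Proof.
apply: continuous_compact_integrable; first exact: segment_compact.
exact/continuous_subspaceT/continuous_horner.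
Qed.

Lemma poly_intD (R : realType) (a b : R) :
  {morph poly_int a b : p q / p + q}.
Proof.
move=> p q; rewrite /poly_int -RintegralD//; last 2 first.
- exact: integrable_horner.
- exact: integrable_horner.
by apply: eq_Rintegral => x _; rewrite hornerD.
Qed.

Lemma poly_intZ (R : realType) (a b c : R) (p : {poly R}) :
  poly_int a b (c *: p) = c * poly_int a b p.
Proof.
rewrite /poly_int -RintegralZl//; last exact: integrable_horner.
by apply: eq_Rintegral => x _; rewrite hornerZ.
Qed.

Lemma poly_intB (R : realType) (a b : R) :
  {morph poly_int a b : p q / p - q}.
Proof. by move=> p q; rewrite -scaleN1r poly_intD poly_intZ mulN1r. Qed.

Lemma poly_int0 (R : realType) (a b : R) : poly_int a b 0 = 0.
Proof. by rewrite -(scale0r 0) poly_intZ mul0r. Qed.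

Lemma poly_int_sum (R : realType) (a b : R) (I : finType) (F : I -> {poly R}) :
  poly_int a b (\sum_i F i) = \sum_i poly_int a b (F i).
Proof.
by apply: (big_morph (poly_int a b)); [exact: poly_intD|exact: poly_int0].
Qed.

Lemma poly_int_ge0 (R : realType) (a b : R) (p : {poly R}) :
  (forall x, a <= x <= b -> 0 <= p.[x]) -> 0 <= poly_int a b p.
Proof.
by move=> p0; apply: Rintegral_ge0 => x /=; rewrite in_itv/=; exact: p0.
Qed.

Lemma le_poly_int (R : realType) (a b : R) (p q : {poly R}) :
  (forall x, a <= x <= b -> p.[x] <= q.[x]) -> poly_int a b p <= poly_int a b q.
Proof.
move=> pq; rewrite -subr_ge0 -poly_intB; apply: poly_int_ge0 => x xab.
by rewrite hornerD hornerN subr_ge0 pq.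
Qed.

Lemma poly_int_deriv (R : realType) (a b : R) (F : {poly R}) : a < b ->
  poly_int a b F^`() = F.[b] - F.[a].
Proof.
move=> ab; rewrite /poly_int /Rintegral (@continuous_FTC2 _ _ (horner F)) //.
- exact/continuous_subspaceT/continuous_horner.
- split=> [x _| |]; first exact: derivable_horner.
  + by apply: cvg_at_right_filter; exact: continuous_horner.
  + by apply: cvg_at_left_filter; exact: continuous_horner.
- by move=> x _; rewrite -derivE.
Qed.

Lemma antideriv_exists (R : realType) (p : {poly R}) :
  exists F : {poly R}, F^`() = p.
Proof.
exists (\poly_(i < (size p).+1) (p`_i.-1 / i%:R)).
apply/polyP => i; rewrite coef_deriv coef_poly ltnS /=.
case: ltnP => [ip|pi]; last by rewrite mul0rn nth_default.
by rewrite -[LHS]mulr_natr divfK ?pnatr_eq0.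
Qed.

(** Comparing antiderivatives replaces a change of variables in the integral. *)
Lemma poly_int_affine (R : realType) (p : {poly R}) :
  poly_int 0 1 p = poly_int (-1) 1 (p \Po (2^-1 *: ('X + 1))) / 2.
Proof.
have [F <-] := antideriv_exists p.
rewrite poly_int_deriv //.
have /= := @poly_int_deriv _ (-1) 1 (F \Po (2^-1 *: ('X + 1))).
rewrite deriv_comp derivZ derivD derivX derivC addr0 -mul_polyC mulr1 mulrC.
rewrite mul_polyC poly_intZ !horner_comp !hornerE => e; rewrite mulrC e.
  by congr (F.[_] - F.[_]); lra.
by lra.
Qed.

Lemma poly_int1 (R : realType) : poly_int (-1) 1 1 = 2 :> R.
Proof.
have := @poly_int_deriv R (-1) 1 'X.
by rewrite derivX !hornerE => -> //; lra.
Qed.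

Lemma poly_int_norm_le (R : realType) (p : {poly R}) (M : R) :
  (forall x, -1 <= x <= 1 -> `|p.[x]| <= M) -> `|poly_int (-1) 1 p| <= 2 * M.
Proof.
move=> pM; have e c : poly_int (-1) 1 c%:P = 2 * c :> R.
  by rewrite -[c%:P]mulr1 mul_polyC poly_intZ poly_int1 mulrC.
rewrite ler_norml -mulrN -!e; apply/andP.
by split; apply: le_poly_int => x /pM; rewrite ler_norml hornerC => /andP[].
Qed.

(** * Chebyshev polynomials *)

Fixpoint chebT (R : realType) (n : nat) : {poly R} :=
  match n with
  | 0 => 1
  | n1.+1 => match n1 with
             | 0 => 'X
             | n2.+1 => 2 *: ('X * chebT R n1) - chebT R n2
             end
  end.

(** The polynomials of the second kind only serve to integrate those of the
    first kind: they are, up to a factor, the derivatives of the latter. *)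
Fixpoint chebU (R : realType) (n : nat) : {poly R} :=
  match n with
  | 0 => 1
  | n1.+1 => match n1 with
             | 0 => 2 *: 'X
             | n2.+1 => 2 *: ('X * chebU R n1) - chebU R n2
             end
  end.

(** Chebyshev polynomials satisfy a three-term recurrence, so identities between
    them are proved by this two-step induction. *)
Lemma nat_ind2 (P : nat -> Prop) :
  P 0%N -> P 1%N -> (forall n, P n -> P n.+1 -> P n.+2) -> forall n, P n.
Proof.
move=> P0 P1 PS n; suff [] : P n /\ P n.+1 by [].
by elim: n => // n [Pn Pn1]; split => //; exact: PS.
Qed.

Section chebyshev.
Variable R : realType.
Local Notation T := (chebT R).
Local Notation U := (chebU R).

Lemma chebTS n : T n.+2 = 2 *: ('X * T n.+1) - T n.
Proof. by []. Qed.

Lemma chebUS n : U n.+2 = 2 *: ('X * U n.+1) - U n.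
Proof. by []. Qed.

Lemma mulX_chebT n : 'X * T n.+1 = 2^-1 *: (T n.+2 + T n).
Proof. by rewrite chebTS subrK scalerA mulVf ?scale1r// pnatr_eq0. Qed.

Lemma size_chebT n : (size (T n) <= n.+1)%N.
Proof.
elim/nat_ind2: n => [||n h0 h1]; rewrite ?size_poly1 ?size_polyX//.
rewrite chebTS (leq_trans (size_polyD _ _))// size_polyN geq_max.
rewrite (leq_trans (size_scale_leq _ _))/=; last first.
  by rewrite (leq_trans (size_polyMleq _ _))// size_polyX.
by rewrite (leq_trans h0)// ltnW.
Qed.

Lemma horner_chebT_cos n t : (T n).[cos t] = cos (n%:R * t).
Proof.
elim/nat_ind2: n => [||n h0 h1].
- by rewrite mul0r cos0 hornerE.
- by rewrite mul1r hornerX.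
rewrite chebTS hornerD hornerN hornerZ hornerM hornerX h0 h1.
have -> : n.+2%:R * t = n.+1%:R * t + t by rewrite -natr1; ring.
have -> : n%:R * t = n.+1%:R * t - t by rewrite -natr1; ring.
by rewrite cosB cosD; ring.
Qed.

(** On [[-1, 1]] every point is a cosine, and [T_n (cos t) = cos (n t)]. *)
Lemma normr_chebT_le1 n x : -1 <= x <= 1 -> `|(T n).[x]| <= 1.
Proof.
by move=> x1; rewrite -(acosK x1) horner_chebT_cos ler_norml cos_geN1 cos_le1.
Qed.

Lemma horner_chebT1 n : (T n).[1] = 1.
Proof. by rewrite -cos0 horner_chebT_cos mulr0. Qed.

Lemma horner_chebTN1 n : (T n).[-1] = (-1) ^+ n.
Proof.
elim/nat_ind2: n => [||n h0 h1].
- by rewrite hornerE.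
- by rewrite hornerX.
by rewrite chebTS hornerD hornerN hornerZ hornerM hornerX h0 h1 !exprS; ring.
Qed.

Lemma chebT_chebU n : T n.+1 = U n.+1 - 'X * U n.
Proof.
elim/nat_ind2: n => [||n h0 h1].
- by rewrite /= mulr1 scaler_nat mulr2n addrK.
- by rewrite /= -!mul_polyC; ring.
- by rewrite chebTS h0 h1 [U n.+3]chebUS [U n.+2]chebUS -!mul_polyC; ring.
Qed.

Lemma deriv_chebT n : (T n.+1)^`() = n.+1%:R *: U n.
Proof.
elim/nat_ind2: n => [||n h0 h1].
- by rewrite /= derivX scale1r.
- by rewrite /= derivB derivZ derivM derivX derivC !hornerE -!mul_polyC; ring.
rewrite chebTS derivB derivZ derivM derivX h0 h1 [in RHS]chebUS.
rewrite [T n.+2]chebT_chebU chebUS.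
rewrite -!mul_polyC -[n.+3%:R]natr1 -[n.+2%:R]natr1.
by rewrite !(polyCD, polyC1); ring.
Qed.

Lemma chebU_chebT n : U n.+2 - U n = 2 *: T n.+2.
Proof. by rewrite chebT_chebU chebUS -!mul_polyC; ring. Qed.

(** [T_n] is the derivative of [(T_{n+1} / (n+1) - T_{n-1} / (n-1)) / 2], whose
    end values are known; the parity factor comes from [T_n (-1) = (-1)^n]. *)
Lemma poly_int_chebT n : poly_int (-1) 1 (T n.+2) =
  (1 + (-1) ^+ n) / 2 * (n.+3%:R^-1 - n.+1%:R^-1).
Proof.
have -> : T n.+2 =
    (2^-1 *: (n.+3%:R^-1 *: T n.+3 - n.+1%:R^-1 *: T n.+1))^`().
  rewrite derivZ derivB !derivZ !deriv_chebT !scalerA !mulVf ?pnatr_eq0//.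
  by rewrite !scale1r chebU_chebT scalerA mulVf ?scale1r// pnatr_eq0.
rewrite poly_int_deriv; last by lra.
have hornerF a b c (p q : {poly R}) x :
    (c *: (a *: p - b *: q)).[x] = c * (a * p.[x] - b * q.[x]).
  by rewrite !hornerE.
rewrite !hornerF !horner_chebT1 !horner_chebTN1 !exprS; ring.
Qed.

Lemma poly_int_chebT_odd n : odd n -> poly_int (-1) 1 (T n.+2) = 0.
Proof. by move=> on; rewrite poly_int_chebT -signr_odd on subrr !mul0r. Qed.

(** The exact value is [2 / (1 - n^2)] for even [n], and 35 is [6^2 - 1]. *)
Lemma poly_int_chebT_le n : (6 <= n)%N -> `|poly_int (-1) 1 (T n)| <= 2 / 35.
Proof.
case: n => [|[|[|[|[|n]]]]] // n6; rewrite poly_int_chebT -signr_odd.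
have n1 : 1 <= n%:R :> R by rewrite ler1n; lia.
case: odd; first by rewrite subrr !mul0r normr0; lra.
have -> : (1 + (-1) ^+ false) / 2 * (n.+2.+4%:R^-1 - n.+4%:R^-1) =
    - (2 / ((n%:R + 6) * (n%:R + 4))) :> R.
  by rewrite -!natr1; field; apply/andP; split; lra.
rewrite normrN ger0_norm; last by apply: divr_ge0; nra.
by rewrite ler_pdivrMr; nra.
Qed.

End chebyshev.

(** * Functionals bounded on Chebyshev polynomials *)

Section functional.
Variables (R : realType) (rho : R).
Hypothesis rho_ge1 : 1 <= rho.

Let rho_gt0 : 0 < rho. Proof. by rewrite (lt_le_trans _ rho_ge1). Qed.

(** The Chebyshev polynomial [T_j] evaluated at [(rho + 1/rho) / 2], the
    rightmost point of the Bernstein ellipse of parameter [rho]. *)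
Definition ellipse_weight (j : nat) : R := (rho ^+ j + (rho ^+ j)^-1) / 2.

(** The maximum of [|1 + x| / 2] over the same ellipse, attained at its
    rightmost point: the factor by which multiplication by [(1 + x) / 2] or
    [(1 - x) / 2] can enlarge a bound. *)
Definition ellipse_growth : R := (1 + ellipse_weight 1) / 2.

Lemma ellipse_weight0 : ellipse_weight 0 = 1.
Proof. by rewrite /ellipse_weight expr0 invr1; lra. Qed.

Lemma ellipse_weight_ge0 j : 0 <= ellipse_weight j.
Proof. by rewrite divr_ge0// addr_ge0// ?invr_ge0 exprn_ge0 ?ltW. Qed.

Lemma ellipse_weightS j : ellipse_weight j.+2 + ellipse_weight j =
  2 * ellipse_weight 1 * ellipse_weight j.+1.
Proof.
rewrite /ellipse_weight !exprS expr0 !mulr1; field.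
by rewrite expf_neq0 !gt_eqF.
Qed.

Lemma ellipse_growth_ge0 : 0 <= ellipse_growth.
Proof. by rewrite divr_ge0// addr_ge0// ellipse_weight_ge0. Qed.

Variable E : {poly R} -> R.
Hypothesis E_lin : forall a p q, E (a *: p + q) = a * E p + E q.

Let ED p q : E (p + q) = E p + E q.
Proof. by rewrite -[p]scale1r E_lin mul1r scale1r. Qed.

Let EZ a p : E (a *: p) = a * E p.
Proof.
have E0 : E 0 = 0.
  by have := E_lin 1 0 0; rewrite scale1r addr0 mul1r => /eqP; lra.
by rewrite -[a *: p]addr0 E_lin E0 addr0.
Qed.

(** Multiplying by [x] turns [T_j] into the mean of its two neighbours, and the
    mean of the neighbouring weights is [w_1 w_j]. This is why the bound is
    asked for all [j] simultaneously. *)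
Lemma functional_step (B : R) (c : {poly R}) (e : R) : `|e| <= 1 ->
  (forall j, `|E (c * chebT R j)| <= B * ellipse_weight j) ->
  forall j, `|E (2^-1 *: (1 + e *: 'X) * c * chebT R j)|
            <= B * ellipse_growth * ellipse_weight j.
Proof.
move=> e1 cB [|j].
  have -> : 2^-1 *: (1 + e *: 'X) * c * chebT R 0 =
      2^-1 *: (c * chebT R 0 + e *: (c * chebT R 1)).
    by rewrite /= -!mul_polyC; ring.
  rewrite EZ ED EZ ellipse_weight0 normrM gtr0_norm ?invr_gt0//.
  have := cB 0%N; have := cB 1%N; rewrite ellipse_weight0.
  move: (E (c * chebT R 0)) (E (c * chebT R 1)) => v u hu hv.
  rewrite /ellipse_growth.
  have := ler_normD v (e * u); rewrite normrM.
  have : `|e| * `|u| <= 1 * `|u| by rewrite ler_wpM2r.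
  by move=> h1 h2; rewrite ler_pdivrMl//; lra.
have -> : 2^-1 *: (1 + e *: 'X) * c * chebT R j.+1 =
    2^-1 *: (c * chebT R j.+1 + (e / 2) *: (c * chebT R j.+2 + c * chebT R j)).
  transitivity (2^-1 *: (c * chebT R j.+1 + e *: (c * ('X * chebT R j.+1)))).
    by rewrite -!mul_polyC; ring.
  by rewrite mulX_chebT -!mul_polyC polyCM; ring.
rewrite EZ ED EZ ED normrM gtr0_norm ?invr_gt0//.
have := cB j; have := cB j.+1; have := cB j.+2; have := ellipse_weightS j.
move: (E (c * chebT R j.+1)) (E (c * chebT R j.+2)) (E (c * chebT R j)).
move=> u v w hw hv hu hz; rewrite /ellipse_growth.
have -> : B * ((1 + ellipse_weight 1) / 2) * ellipse_weight j.+1 =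
   (B * ellipse_weight j.+1
    + (B * ellipse_weight j.+2 + B * ellipse_weight j) / 2) / 2.
  by rewrite -mulrDr hw; field.
have := ler_normD u (e / 2 * (v + w)); rewrite !normrM.
move: (ler_normD v w) hu hv hz; rewrite [`|2^-1|]gtr0_norm ?invr_gt0//.
have : `|e| * `|v + w| <= 1 * `|v + w| by rewrite ler_wpM2r.
by move=> h1 h2 h3 h4 h5 h6; rewrite ler_pdivrMl//; lra.
Qed.

(** Starting from [c = 1], multiply in the [k + p] factors one at a time and
    read off the bound at [j = 0], where both [T_0] and the weight are 1. *)
Lemma functional_bernstein_bound (K : R) (k p : nat) :
  (forall j, `|E (chebT R j)| <= K * ellipse_weight j) ->
  `|E ((2^-1 *: (1 - 'X)) ^+ k * (2^-1 *: (1 + 'X)) ^+ p)|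
    <= K * ellipse_growth ^+ (k + p).
Proof.
move=> TK.
suff /(_ 0%N) : forall j,
    `|E ((2^-1 *: (1 - 'X)) ^+ k * (2^-1 *: (1 + 'X)) ^+ p * chebT R j)|
    <= K * ellipse_growth ^+ (k + p) * ellipse_weight j.
  by rewrite ellipse_weight0 !mulr1.
have sigS d :
    K * ellipse_growth ^+ d.+1 = K * ellipse_growth ^+ d * ellipse_growth.
  by rewrite exprSr mulrA.
elim: k => [|k IHk] j; last first.
  rewrite addSn sigS exprS -(mulrA (_ *: _)).
  have := @functional_step _ _ (-1) _ IHk; rewrite scaleN1r; apply.
  by rewrite normrN1.
elim: p j => [|p IHp] j; first by rewrite !expr0 !mul1r mulr1.
rewrite addnS sigS exprS mulrCA.
have := @functional_step _ _ 1 _ IHp; rewrite scale1r; apply.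
by rewrite normr1.
Qed.

End functional.

(** * Interpolatory rules *)

Section interpolatory.
Variables (R : realType) (n : nat) (s : 'I_n.+1 -> R).

Definition quad_err (p : {poly R}) : R :=
  poly_int (-1) 1 p - \sum_(i < n.+1) interpolatory_weight s i * p.[s i].

Lemma quad_err_lin a p q : quad_err (a *: p + q) = a * quad_err p + quad_err q.
Proof.
rewrite /quad_err poly_intD poly_intZ mulrBr mulr_sumr.
rewrite addrACA -opprD -big_split/=; congr (_ - _); apply: eq_bigr => i _.
by rewrite hornerD hornerZ; ring.
Qed.

Lemma size_lagrange_basis i : (size (lagrange_basis s i) <= n.+1)%N.
Proof.
have card_n : #|[pred j : 'I_n.+1 | j != i]| = n.
  by transitivity #|predC1 i|; [exact: eq_card|rewrite cardC1 card_ord].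
apply: leq_trans (size_poly_prod_leq _ _) _; rewrite card_n.
suff : (\sum_(j < n.+1 | j != i) size ((s i - s j)^-1 *: ('X - (s j)%:P))
        <= n * 2)%N by move: (\sum_(_ < _ | _) _)%N => S; lia.
rewrite -[X in (_ <= X * 2)%N]card_n -sum_nat_const.
apply: leq_sum => j _; apply: leq_trans (size_scale_leq _ _) _.
by rewrite size_XsubC.
Qed.

Hypothesis s_inj : injective s.

Lemma horner_lagrange_basis i j : (lagrange_basis s i).[s j] = (i == j)%:R.
Proof.
rewrite horner_prod; case: eqVneq => [<-|ij] /=.
  rewrite big1// => k ki; rewrite hornerZ hornerXsubC mulVf// subr_eq0.
  by apply: contra ki => /eqP/s_inj ->.
by rewrite (bigD1 j) 1?eq_sym//= hornerZ hornerXsubC subrr mulr0 mul0r.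
Qed.

Lemma poly_eq_on_nodes (p q : {poly R}) :
  (size p <= n.+1)%N -> (size q <= n.+1)%N -> (forall i, p.[s i] = q.[s i]) ->
  p = q.
Proof.
move=> sp sq pq; apply/eqP; rewrite -subr_eq0; apply/negPn/negP => d0.
have /(_ (codom s)) := max_poly_roots d0.
rewrite size_codom card_ord ltnNge.
have -> : (size (p - q)%R <= n.+1)%N.
  by rewrite (leq_trans (size_polyD _ _))// size_polyN geq_max sp.
move=> /(_ _ _)/negP; apply=> //; last exact/injectiveP.
by apply/allP => _ /codomP[i ->]; rewrite rootE hornerD hornerN pq subrr.
Qed.

Lemma lagrange_interpolation (p : {poly R}) : (size p <= n.+1)%N ->
  p = \sum_i p.[s i] *: lagrange_basis s i.
Proof.
move=> sp; apply: poly_eq_on_nodes => //.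
  apply: (big_ind (fun q : {poly R} => (size q <= n.+1)%N)).
  - by rewrite size_poly0.
  - by move=> u v su sv; rewrite (leq_trans (size_polyD _ _))// geq_max su.
  - move=> i _; apply: leq_trans (size_scale_leq _ _) _.
    exact: size_lagrange_basis.
move=> j; rewrite horner_sum (bigD1 j)//= hornerZ horner_lagrange_basis eqxx.
rewrite mulr1 big1 ?addr0// => i ij.
by rewrite hornerZ horner_lagrange_basis (negPf ij) mulr0.
Qed.

Lemma quad_err_exact (p : {poly R}) : (size p <= n.+1)%N -> quad_err p = 0.
Proof.
move=> /lagrange_interpolation e; rewrite /quad_err {1}e poly_int_sum.
apply/eqP; rewrite subr_eq0; apply/eqP/eq_bigr => i _.
by rewrite poly_intZ mulrC.
Qed.

End interpolatory.

(** * The two quadrature rules on Chebyshev polynomials *)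

Section clenshaw_curtis.
Variables (R : realType) (n : nat).
Hypothesis n_gt0 : (0 < n)%N.
Local Notation s := (@clenshaw_curtis_nodes R n).

Let nR_gt0 : 0 < n%:R :> R. Proof. by rewrite ltr0n. Qed.

Lemma clenshaw_curtis_nodes_inj : injective s.
Proof.
have in0pi (i : 'I_n.+1) : (i%:R * pi / n%:R : R) \in `[0, pi]%R.
  rewrite in_itv/= divr_ge0 ?mulr_ge0 ?pi_ge0//= ler_pdivrMr// mulrC.
  by rewrite ler_wpM2l ?pi_ge0// ler_nat -ltnS.
move=> i j /(cos_inj (in0pi i) (in0pi j)) /(mulIf _) e.
have /e/(mulIf _) {}e : (n%:R : R)^-1 != 0 by rewrite invr_eq0 gt_eqF.
apply/val_inj/eqP; rewrite -(@eqr_nat R); apply/eqP/e.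
by rewrite gt_eqF// pi_gt0.
Qed.

Lemma chebT_alias_shift q r i :
  (chebT R (n * 2 * q + r)).[s i] = (chebT R r).[s i].
Proof.
rewrite !horner_chebT_cos -[RHS](periodicn (@cosD2pi R) (q * i)).
congr cos; rewrite -[_ *+ (q * i)]mulr_natr mulr2n natrD !natrM; field.
by rewrite gt_eqF.
Qed.

Lemma chebT_alias_reflect r i : (r <= n * 2)%N ->
  (chebT R (n * 2 - r)).[s i] = (chebT R r).[s i].
Proof.
move=> rn; rewrite !horner_chebT_cos -[RHS]cosN.
rewrite -[RHS](periodicn (@cosD2pi R) i).
congr cos; rewrite -[_ *+ i]mulr_natr mulr2n natrB// natrM; field.
by rewrite gt_eqF.
Qed.

(** Aliasing: at the Clenshaw-Curtis nodes [cos (i pi / n)], the values of [T_k]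
    depend only on [k] modulo [2n] and up to sign, so that [T_k] cannot be told
    from some [T_k'] of degree at most [n]. *)
Lemma chebT_alias k : exists2 k', (k' <= n)%N &
  forall i, (chebT R k).[s i] = (chebT R k').[s i].
Proof.
have rn : (k %% (n * 2) < n * 2)%N by rewrite ltn_mod muln_gt0 n_gt0.
have kE i : (chebT R k).[s i] = (chebT R (k %% (n * 2))).[s i].
  by rewrite {1}(divn_eq k (n * 2)) mulnC chebT_alias_shift.
have [rn1|nr] := leqP (k %% (n * 2)) n; first by exists (k %% (n * 2))%N.
exists (n * 2 - k %% (n * 2))%N; first by lia.
by move=> i; rewrite kE chebT_alias_reflect// ltnW.
Qed.

(** The rule integrates [T_k'] exactly, so applied to [T_k] it returns the
    integral of [T_k']. *)
Lemma quad_err_alias k k' : (k' <= n)%N ->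
  (forall i, (chebT R k).[s i] = (chebT R k').[s i]) ->
  quad_err s (chebT R k)
  = poly_int (-1) 1 (chebT R k) - poly_int (-1) 1 (chebT R k').
Proof.
move=> kn kk'; rewrite /quad_err; congr (_ - _).
have /eqP := quad_err_exact clenshaw_curtis_nodes_inj
  (leq_trans (size_chebT R k') (kn : k' < n.+1)%N).
rewrite subr_eq0 => /eqP ->; apply: eq_bigr => i _.
by rewrite kk'.
Qed.

(** By aliasing the error is a difference of two integrals; the aliased one is
    at most the length 2 of the interval. *)
Lemma clenshaw_curtis_chebT_le k : (6 <= k)%N ->
  `|quad_err s (chebT R k)| <= 72 / 35.
Proof.
move=> k6; have [k' kn kk'] := chebT_alias k.
rewrite (quad_err_alias kn kk').
have := poly_int_chebT_le R k6.
have := poly_int_norm_le (@normr_chebT_le1 R k').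
have := ler_normB (poly_int (-1) 1 (chebT R k)) (poly_int (-1) 1 (chebT R k')).
by move=> h1 h2 h3; lra.
Qed.

Lemma clenshaw_curtis_chebT_exact k : (k <= n)%N ->
  quad_err s (chebT R k) = 0.
Proof.
move=> kn; apply: quad_err_exact; first exact: clenshaw_curtis_nodes_inj.
exact: leq_trans (size_chebT R k) _.
Qed.

End clenshaw_curtis.

(** The extra degree of exactness for even [n]: [T_{n+1}] aliases to [T_{n-1}],
    and both have odd degree, hence zero integral. *)
Lemma clenshaw_curtis_chebT_even (R : realType) (n : nat) :
  (4 <= n)%N -> ~~ odd n ->
  quad_err (@clenshaw_curtis_nodes R n) (chebT R n.+1) = 0.
Proof.
case: n => [|[|[|n]]] // n4 en.
rewrite (@quad_err_alias _ _ _ _ n.+2)//; last first.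
  move=> i; rewrite -chebT_alias_reflect//; last by lia.
  by congr (chebT R _).[_]; lia.
rewrite !poly_int_chebT_odd ?subrr//; rewrite /= !negbK in en *; by [].
Qed.

Section gauss_legendre.
Variable R : realType.

(** Each derivative of a power loses only one factor of the base, so the
    derivatives of [(x^2 - 1)^N] of order below [N] vanish at the end points. *)
Lemma derivn_exp_factor (g : {poly R}) (N i : nat) : (i <= N)%N ->
  exists v, (g ^+ N)^`(i) = g ^+ (N - i) * v.
Proof.
elim: i => [|i IHi] iN; first by exists 1; rewrite derivn0 subn0 mulr1.
have [v vE] := IHi (ltnW iN).
exists ((N - i)%:R *: (g^`() * v) + g * v^`()).
have NiE : (N - i = (N - i.+1).+1)%N by lia.
rewrite derivnS vE derivM deriv_exp -mulr_natl NiE exprS /= -!mul_polyC.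
by rewrite polyC_natr; ring.
Qed.

Lemma derivn_exp_root (g : {poly R}) (N i : nat) (a : R) : (i < N)%N ->
  root g a -> (g ^+ N)^`(i).[a] = 0.
Proof.
move=> iN /rootP ga; have [v ->] := derivn_exp_factor g (ltnW iN).
by rewrite hornerM horner_exp ga expr0n subn_eq0 leqNgt iN mul0r.
Qed.

Local Notation U N := (('X ^+ 2 - 1 : {poly R}) ^+ N).

(** Integration by parts [k] times, all boundary terms being zero, until the
    polynomial [q] of degree below [k] has been differentiated away. *)
Lemma rodrigues_orthogonal (N k : nat) (q : {poly R}) : (k <= N)%N ->
  (size q <= k)%N -> poly_int (-1) 1 ((U N)^`(k) * q) = 0.
Proof.
elim: k q => [|k IHk] q kN qk.
  by move: qk; rewrite leqn0 size_poly_eq0 => /eqP ->; rewrite mulr0 poly_int0.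
have -> : (U N)^`(k.+1) * q = ((U N)^`(k) * q)^`() - (U N)^`(k) * q^`().
  by rewrite derivM -derivnS addrK.
rewrite poly_intB poly_int_deriv; last by lra.
have r1 : root ('X ^+ 2 - 1 : {poly R}) 1.
  by rewrite rootE !hornerE expr1n subrr.
have rN1 : root ('X ^+ 2 - 1 : {poly R}) (-1).
  by rewrite rootE !hornerE sqrrN expr1n subrr.
rewrite !hornerM !derivn_exp_root// !mul0r subrr IHk ?subrr//.
  exact: ltnW.
by rewrite size_deriv; case: (size q) qk.
Qed.

Lemma size_legendre N : size (legendre R N) = N.+1.
Proof.
rewrite /legendre size_scale; last first.
  by rewrite invr_eq0 mulf_neq0 ?expf_neq0 ?pnatr_eq0 -?lt0n ?fact_gt0.
have sX : size ('X ^+ 2 - 1 : {poly R}) = 3%N by rewrite size_XnsubC.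
rewrite size_derivn; have := size_exp ('X ^+ 2 - 1 : {poly R}) N.
have : (0 < size (U N))%N.
  by rewrite lt0n size_poly_eq0 expf_neq0// -size_poly_eq0 sX.
by rewrite sX; move: (size (U N)) => m; lia.
Qed.

Variables (n : nat) (s : 'I_n.+1 -> R).
Hypothesis s_nodes : gauss_legendre_nodes s.
Let s_inj : injective s := s_nodes.1.
Let L := legendre R n.+1.
Local Notation w := (interpolatory_weight s).

(** Division by the Legendre polynomial: the multiple of it is killed by the
    integral (orthogonality) and by the rule (its roots are the nodes), and the
    remainder is integrated exactly because the rule is interpolatory. *)
Lemma gauss_quad_err_exact (p : {poly R}) : (size p <= n.+1 * 2)%N ->
  quad_err s p = 0.
Proof.
move=> sp; have sL : size L = n.+2 := size_legendre n.+1.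
have L0 : L != 0 by rewrite -size_poly_eq0 sL.
have Ls i : L.[s i] = 0 by apply/rootP/(s_nodes.2 (s i)).2; exists i.
rewrite (divp_eq p L) -{1}[p %/ L * L]scale1r quad_err_lin mul1r.
rewrite [quad_err s (p %% L)]quad_err_exact//; last first.
  by rewrite -ltnS -sL ltn_modp.
rewrite addr0 /quad_err big1 ?subr0; last first.
  by move=> i _; rewrite hornerM Ls !mulr0.
rewrite [_ %/ _ * _]mulrC {2}/L /legendre -scalerAl poly_intZ.
rewrite rodrigues_orthogonal ?mulr0//.
rewrite size_divp// sL /=; move: (size p) sp => d; lia.
Qed.

(** The rule is exact on [q * l_i^2], and [l_i^2] selects the single node [s_i].
    With [q = 1] this gives the sign of the weight, with [q = x] the position of
    the node. *)
Lemma gauss_lagrange_sqr (q : {poly R}) i : (size q <= 2)%N ->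
  poly_int (-1) 1 (q * lagrange_basis s i ^+ 2) = w i * q.[s i].
Proof.
move=> q2; have /eqP : quad_err s (q * lagrange_basis s i ^+ 2) = 0.
  apply: gauss_quad_err_exact; rewrite (leq_trans (size_polyMleq _ _))//.
  have := size_polyMleq (lagrange_basis s i) (lagrange_basis s i).
  have := size_lagrange_basis s i; rewrite expr2.
  move: (size q) (size (lagrange_basis s i * lagrange_basis s i)) q2 => a b.
  by move: (size (lagrange_basis s i)) => c; lia.
rewrite subr_eq0 => /eqP ->; rewrite (bigD1 i)//= big1 ?addr0.
  by rewrite hornerM horner_exp horner_lagrange_basis// eqxx expr1n mulr1.
move=> j ji; rewrite hornerM horner_exp horner_lagrange_basis//.
by rewrite eq_sym (negPf ji) expr0n !mulr0.
Qed.

Lemma gauss_weightE i : w i = poly_int (-1) 1 (lagrange_basis s i ^+ 2).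
Proof.
rewrite -[RHS]mul1r -[_ ^+ 2]mul1r gauss_lagrange_sqr ?size_poly1//.
by rewrite hornerC mul1r mulr1.
Qed.

Lemma gauss_weight_ge0 i : 0 <= w i.
Proof.
rewrite gauss_weightE; apply: poly_int_ge0 => x _.
by rewrite horner_exp sqr_ge0.
Qed.

(** The nodes lie in [[-1, 1]], since [w_i s_i] is the integral of [x l_i^2] and
    [w_i] that of [l_i^2]. Keeping the factor [w_i] avoids having to prove that
    it is nonzero: a node of zero weight does no harm. *)
Lemma gauss_weight_node i : w i * `|s i| <= w i.
Proof.
rewrite -{1}(ger0_norm (gauss_weight_ge0 i)) -normrM.
have := @gauss_lagrange_sqr 'X i; rewrite size_polyX hornerX => <- //.
have le1 (e : R) : `|e| = 1 ->
    e * poly_int (-1) 1 ('X * lagrange_basis s i ^+ 2) <= w i.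
  move=> e1; rewrite -poly_intZ gauss_weightE; apply: le_poly_int => x x1.
  rewrite hornerZ hornerM hornerX horner_exp mulrA ler_piMl ?sqr_ge0//.
  by rewrite (le_trans (ler_norm _))// normrM e1 mul1r ler_norml.
have := le1 1 (normr1 _); have := le1 (-1) (normrN1 _).
by rewrite ler_norml => h1 h2; apply/andP; split; lra.
Qed.

(** Nonnegative weights of sum 2 and nodes in [[-1, 1]] make the rule return at
    most 2 in absolute value on every Chebyshev polynomial. *)
Lemma gauss_chebT_le k : (6 <= k)%N -> `|quad_err s (chebT R k)| <= 72 / 35.
Proof.
move=> k6; have sum_w : \sum_i w i = 2.
  have /eqP : quad_err s 1 = 0.
    by apply: gauss_quad_err_exact; rewrite size_poly1.
  rewrite subr_eq0 poly_int1 => /eqP ->; apply: eq_bigr => i _.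
  by rewrite hornerC mulr1.
have Q2 : `|\sum_i w i * (chebT R k).[s i]| <= 2.
  rewrite -sum_w; apply: le_trans (ler_norm_sum _ _ _) _.
  apply: ler_sum => i _; rewrite normrM (ger0_norm (gauss_weight_ge0 i)).
  have := gauss_weight_ge0 i; rewrite le_eqVlt => /orP[/eqP <-|wi].
    by rewrite mul0r.
  rewrite ler_piMr ?(ltW wi)// normr_chebT_le1// -ler_norml.
  by have := gauss_weight_node i; rewrite ger_pMr.
have := poly_int_chebT_le R k6.
have := ler_normB (poly_int (-1) 1 (chebT R k))
  (\sum_i w i * (chebT R k).[s i]).
by rewrite /quad_err => h1 h2; lra.
Qed.

End gauss_legendre.

(** * Choosing the ellipse parameter *)

Section numeric.
Variable R : realType.

Lemma bernoulli_le (x : R) n : 0 <= x -> 1 + n%:R * x <= (1 + x) ^+ n.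
Proof.
move=> x0; elim: n => [|n IHn]; first by rewrite mul0r addr0 expr0.
rewrite exprS -natr1.
have h : 0 <= n%:R * x * x by rewrite !mulr_ge0.
have := ler_wpM2l (_ : 0 <= 1 + x) IHn.
by move=> /(_ _)H; apply: (le_trans _ (H _)); lra.
Qed.

(** From [exp (-1/32) >= 31/32], by repeated squaring with rounding down. *)
Lemma expR1_le_279div100 : expR 1 <= 279 / 100 :> R.
Proof.
have sqr_le (x y u v : R) : y = x + x -> 0 <= u -> v <= u * u -> u <= expR x ->
    v <= expR y.
  by move=> -> u0 vu ux; rewrite expRD (le_trans vu)// ler_pM.
have h32 : 31 / 32 <= expR (- 32^-1) :> R.
  by have := expR_ge1Dx (- 32^-1 : R); lra.
have h16 : 61 / 65 <= expR (- 16^-1) :> R by apply: sqr_le h32; lra.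
have h8 : 44 / 50 <= expR (- 8^-1) :> R by apply: sqr_le h16; lra.
have h4 : 24 / 31 <= expR (- 4^-1) :> R by apply: sqr_le h8; lra.
have h2 : 97 / 162 <= expR (- 2^-1) :> R by apply: sqr_le h4; lra.
have h1 : 100 / 279 <= expR (- 1) :> R by apply: sqr_le h2; lra.
have e1 : expR 1 * expR (- 1) = 1 :> R by rewrite -expRD subrr expR0.
have := ler_wpM2l (ltW (expR_gt0 (1 : R))) h1; rewrite e1; lra.
Qed.

Lemma sqrt2_ge_7div5 : 7 / 5 <= Num.sqrt 2 :> R.
Proof.
have s0 := sqrtr_ge0 (2 : R).
have e2 : Num.sqrt 2 ^+ 2 = 2 :> R by rewrite sqr_sqrtr.
by rewrite leNgt; apply/negP => h; nra.
Qed.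

(** What the Chebyshev argument yields with parameter [rho] for a matrix of norm
    [a], a vector of norm [normb] and a rule exact on [T_0, ..., T_{m+1}]. *)
Definition cheb_bound (a normb rho : R) (p m : nat) : R :=
  72 / 35 * (rho ^+ m.+2)^-1 * ellipse_growth rho ^+ p / p`!%:R
  * expR (a * ellipse_growth rho) * normb.

Lemma cheb_bound_le_quadrature_bound (a B rho : R) (p r : nat) :
  0 <= B -> 1 <= rho ->
  144 / 35 * (rho ^+ 2)^-1 * (rho ^+ (p + r))^-1 * (2 * ellipse_growth rho) ^+ p
    * expR (a * ellipse_growth rho) <= ((r%:R / (expR 1 / 2 * a)) ^+ r)^-1 ->
  cheb_bound a B rho p (p + r) <= quadrature_bound a B p (p + r).
Proof.
move=> B0 rho1 h; rewrite /cheb_bound /quadrature_bound.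
have -> : (p + r)%:R - p%:R = r%:R :> R by rewrite natrD; ring.
have -> : - ((p + r)%N%:Z - p%:Z) = - r%:Z by lia.
rewrite -exprnN.
have c0 : 0 <= B / (2 ^+ p.+1 * p`!%:R).
  by rewrite divr_ge0// mulr_ge0// exprn_ge0.
apply: le_trans (ler_wpM2l c0 h); rewrite le_eqVlt; apply/orP; left.
apply/eqP; rewrite [(2 * _) ^+ p]exprMn -[(p + r).+2]addn2 exprD.
rewrite [2 ^+ p.+1]exprS; field.
by rewrite !expf_neq0 ?pnatr_eq0 -?lt0n ?fact_gt0//= gt_eqF//
  (lt_le_trans _ rho1).
Qed.

(** The inequality amounts to [rho^2 - 2 rho - 1 >= 0], whose positive root is
    [1 + sqrt 2]; this is where the constant in the hypotheses comes from. *)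
Lemma ellipse_growth_le (rho : R) :
  1 + Num.sqrt 2 <= rho -> 2 * ellipse_growth rho <= rho.
Proof.
have s2 := sqrt2_ge_7div5.
have e2 : Num.sqrt 2 ^+ 2 = 2 :> R by rewrite sqr_sqrtr.
move=> h; rewrite /ellipse_growth /ellipse_weight expr1.
have rho0 : 0 < rho by lra.
have : rho^-1 <= rho - 2.
  by rewrite -[rho^-1]mul1r ler_pdivrMr//; nra.
lra.
Qed.

(** The choice [rho = 2 t / a]. Once [sigma] has been replaced by [rho / 2], the
    quotient of the two bounds no longer depends on [p], and what remains is the
    last hypothesis; there 23/4 stands for a lower bound of [rho^2], valid since
    [rho >= 12/5]. *)
Lemma cheb_bound_le_large_rho (a B t : R) (p r : nat) : 0 < a -> 0 <= B ->
  (1 + Num.sqrt 2) / 2 * a <= t -> 0 < r%:R :> R ->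
  expR t * 144 / 35 * r%:R ^+ r <= (23 / 4) * expR 1 ^+ r * t ^+ r ->
  exists2 rho, 1 <= rho &
    cheb_bound a B rho p (p + r) <= quadrature_bound a B p (p + r).
Proof.
have s2 := sqrt2_ge_7div5 => a0 B0 at_ r0 h; pose rho := 2 * t / a.
have t0 : 0 < t by nra.
have rho_s2 : 1 + Num.sqrt 2 <= rho by rewrite ler_pdivlMr//; lra.
have rho1 : 1 <= rho by lra.
have rho0 : 0 < rho by lra.
exists rho => //; apply: cheb_bound_le_quadrature_bound => //.
have sig0 := ellipse_growth_ge0 rho1; have sig := ellipse_growth_le rho_s2.
have -> : r%:R / (expR 1 / 2 * a) = rho * (r%:R / (expR 1 * t)).
  by rewrite /rho; field; rewrite !gt_eqF// expR_gt0.
have c0 : 0 <= 144 / 35 * (rho ^+ 2)^-1 * (rho ^+ (p + r))^-1.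
  have q0 k : 0 <= (rho ^+ k)^-1 by rewrite invr_ge0 exprn_ge0// ltW.
  by rewrite mulr_ge0// mulr_ge0// divr_ge0.
apply: (@le_trans _ _ (144 / 35 * (rho ^+ 2)^-1 * (rho ^+ (p + r))^-1 * rho ^+ p
    * expR t)).
  apply: ler_pM.
  - by rewrite mulr_ge0// exprn_ge0// mulr_ge0.
  - exact/ltW/expR_gt0.
  - apply: ler_wpM2l => //.
    by rewrite lerXn2r ?nnegrE ?(ltW rho0)// mulr_ge0.
  - rewrite ler_expR; have -> : t = a * (rho / 2) by rewrite /rho; field; lra.
    by rewrite ler_wpM2l ?(ltW a0)//; lra.
have -> : (rho ^+ (p + r))^-1 = (rho ^+ p)^-1 * (rho ^+ r)^-1.
  by rewrite exprD invfM.
rewrite [(rho * _) ^+ r]exprMn [(rho ^+ r * _)^-1]invfM.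
have -> : 144 / 35 * (rho ^+ 2)^-1 * ((rho ^+ p)^-1 * (rho ^+ r)^-1) * rho ^+ p
    * expR t = (rho ^+ r)^-1 * (expR t * 144 / 35 / rho ^+ 2).
  by field; rewrite !expf_neq0 ?gt_eqF.
rewrite ler_wpM2l ?invr_ge0 ?exprn_ge0 ?(ltW rho0)//.
clearbody rho; rewrite expr_div_n invf_div exprMn ler_pdivlMr ?exprn_gt0//.
rewrite mulrAC ler_pdivrMr ?exprn_gt0//; apply: le_trans h _.
rewrite -mulrA [leRHS]mulrC ler_wpM2r//; last by nra.
by rewrite mulr_ge0// ?exprn_ge0 ?ltW// expR_gt0.
Qed.

(** With [t = r] the exponentials on the two sides cancel, and only
    [144/35 <= 23/4] is left. *)
Lemma cheb_bound_le_exact (a B : R) (p r : nat) : 0 < a -> 0 <= B ->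
  (1 + Num.sqrt 2) / 2 * a <= r%:R ->
  exists2 rho, 1 <= rho &
    cheb_bound a B rho p (p + r) <= quadrature_bound a B p (p + r).
Proof.
have s2 := sqrt2_ge_7div5 => a0 B0 ar; have r0 : 0 < r%:R :> R by nra.
apply: cheb_bound_le_large_rho ar r0 _ => //.
have -> : expR r%:R = expR 1 ^+ r :> R by rewrite -expRM_natl mulr1.
rewrite -![_ * _ * _ ^+ r]mulrA.
have : 0 <= expR 1 ^+ r * r%:R ^+ r :> R.
  by rewrite mulr_ge0 ?exprn_ge0// ltW// expR_gt0.
by move: (expR 1 ^+ r) (r%:R ^+ r) => u v; nra.
Qed.

(** With [t = r + 1] a factor [e / (1 + 1/r)^r] has to be absorbed. Bernoulli's
    inequality bounds it by [e / 2], and [144/35 * e / 2 <= 23/4] is true,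
    though barely: this is what the bound 2.79 on [e] is for. If [r = 0]
    that factor is [e], which is too much; but then [a < 1] and [p >= 4],
    and the fixed value [rho = 4] leaves the small factor [(25/32)^p]. *)
Lemma cheb_bound_le_offby1 (a B : R) (p r : nat) : 0 < a -> 0 <= B ->
  (4 <= p + r)%N -> (1 + Num.sqrt 2) / 2 * a <= r.+1%:R ->
  exists2 rho, 1 <= rho &
    cheb_bound a B rho p (p + r) <= quadrature_bound a B p (p + r).
Proof.
have s2 := sqrt2_ge_7div5; have e1 := expR1_le_279div100.
have e0 := expR_gt0 (1 : R).
move=> a0 B0 pr ar; case: r pr ar => [|r] pr ar; last first.
  apply: cheb_bound_le_large_rho ar _ _ => //.
  have -> : expR r.+2%:R = expR 1 * expR 1 ^+ r.+1 :> R.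
    by rewrite -exprS -expRM_natl mulr1.
  have two : 2 * r.+1%:R ^+ r.+1 <= r.+2%:R ^+ r.+1 :> R.
    have rV0 : 0 <= r.+1%:R^-1 :> R by rewrite invr_ge0.
    have := bernoulli_le r.+1 rV0; rewrite divff ?pnatr_eq0// => h.
    have -> : r.+2%:R = (1 + r.+1%:R^-1) * r.+1%:R :> R.
      by rewrite mulrDl mul1r mulVf ?pnatr_eq0// natr1.
    by rewrite exprMn ler_wpM2r ?exprn_ge0//; lra.
  have u0 : 0 <= expR 1 ^+ r.+1 :> R by rewrite exprn_ge0 ?ltW.
  have v0 : 0 <= r.+1%:R ^+ r.+1 :> R by rewrite exprn_ge0.
  move: (expR 1 ^+ r.+1) (r.+1%:R ^+ r.+1) (r.+2%:R ^+ r.+1) two u0 v0.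
  move=> u v w vw u0 v0.
  have -> : expR 1 * u * 144 / 35 * v = u * (expR 1 * 144 / 35 * v) by ring.
  have -> : (23 / 4) * u * w = u * ((23 / 4) * w) by ring.
  rewrite ler_wpM2l//.
  by nra.
exists 4; first by lra.
have p4 : (4 <= p)%N by lia.
apply: cheb_bound_le_quadrature_bound => //; first by lra.
rewrite expr0 invr1 addn0.
have -> : ellipse_growth 4 = 25 / 16 :> R.
  by rewrite /ellipse_growth /ellipse_weight; lra.
have e2 : expR (a * (25 / 16)) <= (39 / 5).
  apply: (@le_trans _ _ (expR (2%:R * 1))); first by rewrite ler_expR; nra.
  by rewrite expRM_natl expr2; nra.
have -> : 144 / 35 * (4 ^+ 2)^-1 * (4 ^+ p)^-1 * (2 * (25 / 16)) ^+ p =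
    144 / 560 * (25 / 32) ^+ p :> R.
  rewrite (_ : 25 / 32 = 2 * (25 / 16) / 4) ?expr_div_n; last by lra.
  by field; rewrite expf_neq0.
have : (25 / 32) ^+ p <= (25 / 32) ^+ 4 :> R by apply: ler_wiXn2l => //; lra.
have : 0 <= (25 / 32) ^+ p :> R by apply: exprn_ge0; lra.
have := expR_gt0 (a * (25 / 16)).
move: (expR _) (_ ^+ p) e2 => u v; rewrite !exprS expr0 => *; nra.
Qed.

End numeric.

(** * Complex matrices and the exponential series *)

Local Notation normc := ComplexField.Normc.normc.

Lemma cvgn_sum (R : realType) (I : Type) (r : seq I) (u : I -> nat -> R)
    (l : I -> R) : (forall i, u i n @[n --> \oo] --> l i) ->
  \sum_(i <- r) u i n @[n --> \oo] --> \sum_(i <- r) l i.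
Proof.
move=> ul; elim: r => [|i r IHr].
  by under eq_fun do rewrite big_nil; rewrite big_nil; exact: cvg_cst.
under eq_fun do rewrite big_cons.
by rewrite big_cons; apply: cvgD IHr; exact: ul.
Qed.

Section complex_parts.
Variable R : realType.
Implicit Types (z : R[i]) (e : bool).

(** Indexing the real and imaginary parts by a boolean lets one argument serve
    for both. *)
Definition part e z : R := if e then complex.Im z else complex.Re z.

Lemma part_inj (x y : R[i]) : (forall e, part e x = part e y) -> x = y.
Proof.
case: x y => [x1 x2] [y1 y2] xy.
by have := xy false; have := xy true; rewrite /= => -> ->.
Qed.

Lemma partD e : {morph part e : x y / x + y}.
Proof. by case: e => -[a b] [c d]. Qed.

Lemma part0 e : part e 0 = 0. Proof. by case: e. Qed.

Lemma part_sum e (I : Type) (r : seq I) (P : pred I) (F : I -> R[i]) :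
  part e (\sum_(i <- r | P i) F i) = \sum_(i <- r | P i) part e (F i).
Proof. exact: (big_morph _ (partD e) (part0 e)). Qed.

Lemma part_realM e (a : R) z : part e (a%:C * z) = a * part e z.
Proof. by case: e z => -[x y] /=; rewrite mul0r ?subr0 ?addr0. Qed.

Lemma normc_ge0 z : 0 <= normc z.
Proof. by case: z => x y; exact: sqrtr_ge0. Qed.

Lemma normr_part_le e z : `|part e z| <= normc z.
Proof.
case: z => x y; rewrite -sqrtr_sqr ler_wsqrtr//.
by case: e => /=; rewrite ?lerDl ?lerDr sqr_ge0.
Qed.

Lemma normc_realC (a : R) : normc a%:C = `|a|.
Proof. by rewrite /= expr0n addr0 sqrtr_sqr. Qed.

Lemma normc_sum_le (I : Type) (r : seq I) (P : pred I) (F : I -> R[i]) :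
  normc (\sum_(i <- r | P i) F i) <= \sum_(i <- r | P i) normc (F i).
Proof.
elim/big_ind2: _ => [|x a y b xa yb|//].
  by rewrite ComplexField.Normc.normc0.
by apply: le_trans (le_normcD _ _) _; rewrite lerD.
Qed.

(** Entries of the exponential are defined by separate limits of their real and
    imaginary parts, so convergence in [R[i]] is taken in this sense. *)
Definition cvgc (u : nat -> R[i]) (l : R[i]) : Prop :=
  forall e, part e (u n) @[n --> \oo] --> part e l.

Lemma cvgc_sum (I : Type) (r : seq I) (u : I -> nat -> R[i]) (l : I -> R[i]) :
  (forall i, cvgc (u i) (l i)) ->
  cvgc (fun n => \sum_(i <- r) u i n) (\sum_(i <- r) l i).
Proof.
move=> ul e; rewrite part_sum; under eq_fun do rewrite part_sum.
by apply: cvgn_sum => i; exact: ul.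
Qed.

Lemma cvgcMr (u : nat -> R[i]) (l z : R[i]) :
  cvgc u l -> cvgc (fun n => u n * z) (l * z).
Proof.
move=> ul; have part_mul (w : R[i]) e : part e (w * z) =
    part e w * complex.Re z
    + (if e then 1 else -1) * (part (~~ e) w * complex.Im z).
  by case: w z => a b [c d]; case: e => /=; ring.
move=> e; rewrite part_mul; under eq_fun do rewrite part_mul.
apply: cvgD; first by apply: cvgMl; exact: ul.
by apply: cvgMr; apply: cvgMl; exact: ul.
Qed.

Lemma cvgc_normc_le (u : nat -> R[i]) (l : R[i]) (B : R) :
  cvgc u l -> (forall n, normc (u n) <= B) -> normc l <= B.
Proof.
move=> ul uB; have B0 : 0 <= B := le_trans (normc_ge0 _) (uB 0%N).
have sqr_normc (z : R[i]) :
    normc z ^+ 2 = part false z ^+ 2 + part true z ^+ 2.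
  by case: z => x y /=; rewrite sqr_sqrtr ?addr_ge0 ?sqr_ge0.
rewrite -(@ler_pXn2r _ 2) ?nnegrE ?normc_ge0// sqr_normc.
have /= h : (fun n => normc (u n) ^+ 2) @ \oo -->
    part false l ^+ 2 + part true l ^+ 2.
  under eq_fun do rewrite sqr_normc.
  by apply: cvgD; rewrite expr2; under eq_fun do rewrite expr2;
    apply: cvgM; exact: ul.
have := cvgr_to_le h; apply.
by apply: nearW => n; rewrite ler_pXn2r ?nnegrE ?normc_ge0.
Qed.

End complex_parts.

Section norm_inf.
Variable R : realType.

Lemma norm_inf_ge0 m n (A : 'M[R[i]]_(m, n)) : 0 <= norm_inf A.
Proof. exact: bigmax_ge_id. Qed.

Lemma row_sum_le_norm_inf m n (A : 'M[R[i]]_(m, n)) i :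
  \sum_j normc (A i j) <= norm_inf A.
Proof. exact: (le_bigmax _ (fun i => \sum_j normc (A i j))). Qed.

Lemma normc_le_norm_inf m n (A : 'M[R[i]]_(m, n)) i j :
  normc (A i j) <= norm_inf A.
Proof.
apply: le_trans (row_sum_le_norm_inf A i).
by rewrite (bigD1 j)//= lerDl sumr_ge0// => k _; exact: normc_ge0.
Qed.

Lemma norm_inf_mul m n q (A : 'M[R[i]]_(m, n)) (B : 'M[R[i]]_(n, q)) :
  norm_inf (A *m B) <= norm_inf A * norm_inf B.
Proof.
apply/bigmax_leP; split=> [|i _]; first by rewrite mulr_ge0 ?norm_inf_ge0.
apply: (@le_trans _ _ (\sum_j \sum_k normc (A i k) * normc (B k j))).
  apply: ler_sum => j _; rewrite mxE; apply: le_trans (normc_sum_le _ _ _) _.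
  by apply: ler_sum => k _; rewrite ComplexField.Normc.normcM.
rewrite exchange_big/=.
apply: (@le_trans _ _ (\sum_k normc (A i k) * norm_inf B)).
  apply: ler_sum => k _; rewrite -mulr_sumr ler_wpM2l ?normc_ge0//.
  exact: row_sum_le_norm_inf.
by rewrite -mulr_suml ler_wpM2r ?norm_inf_ge0// row_sum_le_norm_inf.
Qed.

Lemma norm_inf1 n : norm_inf (1%:M : 'M[R[i]]_n) <= 1.
Proof.
apply/bigmax_leP; split=> // i _; rewrite (bigD1 i)//= big1 ?addr0.
  by rewrite mxE eqxx ComplexField.Normc.normc1.
by move=> j ji; rewrite mxE eq_sym (negPf ji) ComplexField.Normc.normc0.
Qed.

Lemma norm_inf_exp n (A : 'M[R[i]]_n) k : norm_inf (A ^+ k) <= norm_inf A ^+ k.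
Proof.
elim: k => [|k IHk]; first by rewrite !expr0; exact: norm_inf1.
rewrite !exprS; apply: le_trans (norm_inf_mul _ _) _.
by rewrite ler_wpM2l ?norm_inf_ge0.
Qed.

Lemma norm_inf_eq0 m n (A : 'M[R[i]]_(m, n)) : norm_inf A <= 0 -> A = 0.
Proof.
move=> A0; apply/matrixP => i j; rewrite mxE.
apply: ComplexField.Normc.eq0_normc; apply/eqP.
by rewrite eq_le normc_ge0 andbT (le_trans (normc_le_norm_inf A i j)).
Qed.

End norm_inf.

Section exponential_series.
Variable R : realType.

Lemma exp_partial_le (x : R) K :
  0 <= x -> \sum_(k < K) x ^+ k / k`!%:R <= expR x.
Proof.
move=> x0; rewrite -(big_mkord xpredT (fun k => x ^+ k / k`!%:R)).
apply: (@nondecreasing_cvgn_le _ (series (exp_coeff x))) => //.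
  by apply: nondecreasing_series => k _ _; exact: exp_coeff_ge0.
exact: is_cvg_series_exp_coeff.
Qed.

Lemma expm_partialE n (A : 'M[R[i]]_n) (a : R) K i j :
  expm_partial (a%:C *: A) K i j =
  \sum_(k < K) (a ^+ k / k`!%:R)%:C * (A ^+ k) i j.
Proof.
rewrite /expm_partial summxE; apply: eq_bigr => k _.
have -> : (a%:C *: A) ^+ k = (a ^+ k)%:C *: A ^+ k.
  elim: (k : nat) => [|d IHd]; first by rewrite !expr0 scale1r.
  rewrite exprS IHd -[_ * _]/(_ *m _) -scalemxAl -scalemxAr scalerA -rmorphM.
  by rewrite -exprS -[_ *m _]/(_ * _) -exprS.
rewrite !mxE mulrA; congr (_ * _).
by rewrite rmorphM fmorphV rmorph_nat mulrC.
Qed.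

(** Each entry of the series is dominated by the scalar exponential series at
    the norm of the matrix, so the limits in the definition do exist. *)
Lemma expm_cvg n (A : 'M[R[i]]_n) i j :
  cvgc (fun K => expm_partial A K i j) (expm A i j).
Proof.
move=> e; pose u k := part e ((k`!%:R^-1 *: A ^+ k) i j).
have uE K : part e (expm_partial A K i j) = series u K.
  by rewrite /expm_partial summxE part_sum /series/= big_mkord.
have -> : part e (expm A i j) = limn (series u).
  rewrite mxE; have -> : series u = fun K => part e (expm_partial A K i j).
    by apply/funext => K; rewrite uE.
  by case: e {u uE}.
under eq_fun do rewrite uE.
apply: normed_cvg; apply: series_le_cvg (is_cvg_series_exp_coeff (norm_inf A)).
- by move=> k /=.
- by move=> k; rewrite exp_coeff_ge0 ?norm_inf_ge0.
move=> k /=; apply: le_trans (normr_part_le _ _) _.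
rewrite mxE ComplexField.Normc.normcM ComplexField.Normc.normcV.
rewrite -[k`!%:R](rmorph_nat (real_complex R)) normc_realC normr_nat mulrC.
rewrite /exp_coeff/= ler_wpM2r ?invr_ge0//.
by rewrite (le_trans (normc_le_norm_inf _ _ _))// norm_inf_exp.
Qed.

End exponential_series.

(** * The quadrature error of the phi-function *)

Section unit_interval.
Variables (R : realType) (n : nat) (s : 'I_n.+1 -> R).

Definition quad01_err (f : R -> R) : R :=
  \int[lebesgue_measure]_(t in `[0, 1]) f t
  - \sum_(i < n.+1) weight01 s i * f (node01 s i).

Lemma quad01_err_poly (p : {poly R}) :
  quad01_err (horner p) = quad_err s (p \Po (2^-1 *: ('X + 1))) / 2.
Proof.
rewrite /quad01_err -/(poly_int 0 1 p) poly_int_affine /quad_err mulrBl.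
congr (_ - _); rewrite mulr_suml; apply: eq_bigr => i _.
rewrite horner_comp hornerZ hornerD hornerX hornerC /weight01 /node01.
by rewrite [2^-1 * _]mulrC mulrAC.
Qed.

(** The rule passes to the limit because it is a finite sum, the integral by
    dominated convergence; this extends to [f] what is known for polynomials. *)
Lemma quad01_err_cvg (P : nat -> {poly R}) (f : R -> R) (M : R) :
  (forall t, (P k).[t] @[k --> \oo] --> f t) ->
  (forall k t, 0 <= t <= 1 -> `|(P k).[t]| <= M) ->
  quad01_err (horner (P k)) @[k --> \oo] --> quad01_err f.
Proof.
move=> Pf PM; apply: cvgB; last first.
  by apply: cvgn_sum => i; apply: cvgMr; exact: Pf.
have mP k := measurable_int _ (integrable_horner 0 1 (P k)).
have mf : measurable_fun `[(0 : R), 1] f.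
  apply: (@measurable_fun_cvg _ _ _ _ (fun k => horner (P k))) => [k|t _].
    by have h := mP k; apply/measurable_EFinP.
  exact: Pf.
have [] := @dominated_convergence _ _ R (@lebesgue_measure R) `[(0 : R), 1]
  (measurable_itv _) (fun k => EFin \o horner (P k)) (EFin \o f)
  (cst M%:E) mP _ _ _ _.
- exact/measurable_EFinP.
- apply: aeW => t _; apply: cvg_EFin; last exact: Pf.
  exact: nearW.
- have -> : cst M%:E = EFin \o horner M%:P.
    by apply/funext => t /=; rewrite hornerC.
  exact: integrable_horner.
- apply: aeW => t k /=; rewrite in_itv/= => t01; rewrite lee_fin; exact: PM.
move=> intf _ cvgI; rewrite /Rintegral.
by apply: fine_cvg; rewrite fineK//; exact: integrable_fin_num.
Qed.

End unit_interval.

Section phi_error.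
Variables (R : realType) (N : nat) (A : 'M[R[i]]_N) (b : 'cV[R[i]]_N).
Variables (p n : nat) (s : 'I_n.+1 -> R).
Local Notation a := (norm_inf A).

Let entry_fun e i l (t : R) : R :=
  part e (expm ((1 - t)%:C *: A) i l) * (t ^+ p / p`!%:R).

(** Entrywise error of the rule on the matrix function
    [t |-> exp((1 - t) A) t^p / p!], before multiplication by [b]. *)
Let err_entry i l : R[i] :=
  quad01_err s (entry_fun false i l) +i* quad01_err s (entry_fun true i l).

Let part_err_entry e i l :
  part e (err_entry i l) = quad01_err s (entry_fun e i l).
Proof. by case: e. Qed.

Let error_entryE i :
  (phi p.+1 A *m b - phi_quadrature s p A b) i 0 = \sum_l err_entry i l * b l 0.
Proof.
rewrite !mxE summxE.
under [X in _ - X]eq_bigr => q _.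
  rewrite mxE [X in _ * X]mxE mulr_sumr.
  under eq_bigr do rewrite mulrA.
  over.
rewrite exchange_big -sumrB; apply: eq_bigr => l _.
rewrite -mulr_suml -mulrBl; congr (_ * _); apply: part_inj => e.
rewrite part_err_entry.
have partB (x y : R[i]) : part e (x - y) = part e x - part e y.
  by case: e x y => -[? ?] [? ?].
rewrite partB; congr (_ - _).
  rewrite mxE /integral01 /entry_fun.
  have partR (z : R[i]) (c : R) : part e (z * c%:C) = part e z * c.
    by rewrite mulrC part_realM mulrC.
  by case: e partR {partB} => /= partR; apply: eq_Rintegral => t _;
    rewrite -partR.
rewrite part_sum; apply: eq_bigr => q _.
by rewrite part_realM /entry_fun; ring.
Qed.

Let mono_poly k : {poly R} := (1 - 'X) ^+ k * 'X ^+ p.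

(** The coefficient of [A^k] in the error, obtained by applying the rule to the
    exponential series term by term. *)
Let taylor_err k : R := quad01_err s (horner (mono_poly k)) / (k`!%:R * p`!%:R).

Let partial_poly e i l K : {poly R} :=
  \sum_(k < K) (part e ((A ^+ k) i l) / (k`!%:R * p`!%:R)) *: mono_poly k.

Let horner_partial_poly e i l K t : (partial_poly e i l K).[t] =
  part e (expm_partial ((1 - t)%:C *: A) K i l) * (t ^+ p / p`!%:R).
Proof.
rewrite expm_partialE part_sum horner_sum mulr_suml; apply: eq_bigr => k _.
rewrite part_realM hornerZ hornerM !horner_exp hornerD hornerN hornerX hornerC.
by rewrite invfM; ring.
Qed.

Let err_partial_poly e i l K : quad01_err s (horner (partial_poly e i l K)) =
  part e (\sum_(k < K) (taylor_err k)%:C * (A ^+ k) i l).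
Proof.
rewrite part_sum quad01_err_poly /partial_poly.
elim: K => [|K IHK].
  rewrite !big_ord0 comp_poly0.
  have := quad_err_lin s (-1) 0 0; rewrite scaler0 addr0 mulN1r addNr => ->.
  by rewrite mul0r.
rewrite !big_ord_recr /= -IHK comp_polyD comp_polyZ.
rewrite [X in quad_err s X]addrC quad_err_lin mulrDl addrC part_realM.
by rewrite /taylor_err quad01_err_poly; congr (_ + _); ring.
Qed.

(** A bound uniform in [K] and [t], as dominated convergence requires. *)
Let partial_poly_bound e i l K t : 0 <= t <= 1 ->
  `|(partial_poly e i l K).[t]| <= expR a.
Proof.
move=> /andP[t0 t1]; rewrite horner_partial_poly expm_partialE part_sum normrM.
have tp : `|t ^+ p / p`!%:R| <= 1.
  rewrite ger0_norm ?divr_ge0 ?exprn_ge0// ler_pdivrMr ?ltr0n ?fact_gt0// mul1r.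
  by rewrite (le_trans (exprn_ile1 p t0 t1))// ler1n fact_gt0.
apply: (@le_trans _ _ ((\sum_(k < K) a ^+ k / k`!%:R) * 1)); last first.
  by rewrite mulr1 exp_partial_le// norm_inf_ge0.
apply: ler_pM => //; apply: le_trans (ler_norm_sum _ _ _) _.
apply: ler_sum => k _; rewrite part_realM normrM mulrC.
have tk : `|(1 - t) ^+ k / k`!%:R| <= k`!%:R^-1.
  rewrite ger0_norm ?divr_ge0 ?exprn_ge0 ?subr_ge0// ler_piMl ?invr_ge0//.
  by rewrite exprn_ile1// ?subr_ge0//; lra.
apply: ler_pM => //; apply: le_trans (normr_part_le _ _) _.
by rewrite (le_trans (normc_le_norm_inf _ _ _))// norm_inf_exp.
Qed.

Let err_entry_cvg i l :
  cvgc (fun K => \sum_(k < K) (taylor_err k)%:C * (A ^+ k) i l) (err_entry i l).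
Proof.
move=> e; rewrite part_err_entry.
under eq_fun do rewrite -err_partial_poly.
apply: (@quad01_err_cvg _ _ _ _ _ (expR a)) => [t|K t t01].
  under eq_fun do rewrite horner_partial_poly.
  by apply: cvgMl; exact: expm_cvg.
exact: partial_poly_bound.
Qed.

(** Bounding the partial sums through [A^k b], rather than entry by entry, keeps
    the maximum norm of [b] as a factor without a loss depending on the
    dimension. *)
Lemma phi_quadrature_error_functional (rho K : R) : 1 <= rho ->
  (forall j, `|quad_err s (chebT R j)| <= K * ellipse_weight rho j) ->
  norm_inf (phi p.+1 A *m b - phi_quadrature s p A b) <=
  K / 2 * ellipse_growth rho ^+ p / p`!%:R * expR (a * ellipse_growth rho)
  * norm_inf b.
Proof.
move=> rho1 TK; set sg := ellipse_growth rho.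
have sg0 : 0 <= sg := ellipse_growth_ge0 rho1.
have K0 : 0 <= K.
  by have := TK 0%N; rewrite ellipse_weight0 mulr1; apply: le_trans.
have taylor_le k :
    `|taylor_err k| <= K / 2 * sg ^+ p / p`!%:R * (sg ^+ k / k`!%:R).
  have f0 m : (0 : R) < m`!%:R by rewrite ltr0n fact_gt0.
  rewrite /taylor_err quad01_err_poly normrM normrM.
  rewrite [`|2^-1|]gtr0_norm ?invr_gt0//.
  rewrite [`|_^-1|]gtr0_norm ?invr_gt0 ?mulr_gt0//.
  have -> : mono_poly k \Po (2^-1 *: ('X + 1)) =
      (2^-1 *: (1 - 'X)) ^+ k * (2^-1 *: (1 + 'X)) ^+ p.
    rewrite /mono_poly rmorphM !rmorphXn rmorphB/= comp_polyX rmorph1.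
    congr (_ ^+ _ * (_ *: _) ^+ _); last exact: addrC.
    have h : (2^-1 : R) *: 1 + (2^-1 : R) *: 1 = 1 :> {poly R}.
      by rewrite -scalerDl (_ : 2^-1 + 2^-1 = 1) ?scale1r//; lra.
    rewrite -[X in X - _]h scalerDr scalerBr opprD; ring.
  have := functional_bernstein_bound rho1 (quad_err_lin s) k p TK.
  rewrite -/sg => h.
  apply: (@le_trans _ _ (K * sg ^+ (k + p) / 2 / (k`!%:R * p`!%:R))).
    by rewrite ler_wpM2r ?invr_ge0 ?mulr_ge0// ler_wpM2r ?invr_ge0.
  by rewrite exprD le_eqVlt; apply/orP; left; apply/eqP; field; rewrite !gt_eqF.
set c := K / 2 * sg ^+ p / p`!%:R.
have c0 : 0 <= c by rewrite !mulr_ge0 ?invr_ge0 ?exprn_ge0.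
apply/bigmax_leP; split=> [|i _].
  by rewrite mulr_ge0 ?norm_inf_ge0// mulr_ge0// (ltW (expR_gt0 _)).
rewrite big_ord1 error_entryE.
apply: (cvgc_normc_le (u := fun d => \sum_l
    (\sum_(k < d) (taylor_err k)%:C * (A ^+ k) i l) * b l 0)).
  by apply: cvgc_sum => l; apply: cvgcMr; exact: err_entry_cvg.
move=> d.
have -> : \sum_l (\sum_(k < d) (taylor_err k)%:C * (A ^+ k) i l) * b l 0 =
    \sum_(k < d) (taylor_err k)%:C * (A ^+ k *m b) i 0.
  under eq_bigr do rewrite mulr_suml.
  rewrite exchange_big; apply: eq_bigr => k _ /=; rewrite mxE mulr_sumr.
  by apply: eq_bigr => l _; rewrite mulrA.
apply: le_trans (normc_sum_le _ _ _) _.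
apply: (@le_trans _ _ (c * (\sum_(k < d) (a * sg) ^+ k / k`!%:R) * norm_inf b)).
  rewrite mulr_sumr mulr_suml; apply: ler_sum => k _.
  rewrite ComplexField.Normc.normcM normc_realC.
  have -> : c * ((a * sg) ^+ k / k`!%:R) * norm_inf b =
      c * (sg ^+ k / k`!%:R) * (a ^+ k * norm_inf b) by rewrite exprMn; ring.
  apply: ler_pM => //; first exact: normc_ge0.
  apply: le_trans (normc_le_norm_inf _ _ _) _.
  apply: le_trans (norm_inf_mul _ _) _.
  by rewrite ler_wpM2r ?norm_inf_ge0// norm_inf_exp.
rewrite ler_wpM2r ?norm_inf_ge0// ler_wpM2l// exp_partial_le//.
by rewrite mulr_ge0 ?norm_inf_ge0.
Qed.

(** The two regimes of [j] are merged into one bound proportional to the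
    weights: if [j >= m + 2], then [1 <= rho^(j-m-2)] and [rho^j <= 2 w_j]. *)
Lemma phi_quadrature_error_cheb (rho : R) (m : nat) : 1 <= rho -> (4 <= m)%N ->
  (forall j, (j <= m.+1)%N -> quad_err s (chebT R j) = 0) ->
  (forall j, (6 <= j)%N -> `|quad_err s (chebT R j)| <= 72 / 35) ->
  norm_inf (phi p.+1 A *m b - phi_quadrature s p A b) <=
  cheb_bound a (norm_inf b) rho p m.
Proof.
move=> rho1 m4 T0 TM; have rho0 : 0 < rho by rewrite (lt_le_trans _ rho1).
have h0 : 0 <= 144 / 35 * (rho ^+ m.+2)^-1.
  by rewrite mulr_ge0 ?invr_ge0 ?exprn_ge0 ?(ltW rho0)// divr_ge0.
have /(phi_quadrature_error_functional rho1) : forall j,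
    `|quad_err s (chebT R j)| <=
    144 / 35 * (rho ^+ m.+2)^-1 * ellipse_weight rho j.
  move=> j; have [jm|mj] := leqP j m.+1.
    by rewrite T0// normr0 mulr_ge0// ellipse_weight_ge0.
  apply: (le_trans (TM j _)); first by lia.
  have h : 1 <= (rho ^+ m.+2)^-1 * rho ^+ j.
    rewrite -(subnKC mj) exprD mulKf ?expf_neq0 ?gt_eqF//.
    by rewrite exprn_ege1.
  have h' : 0 <= (rho ^+ m.+2)^-1 * (rho ^+ j)^-1.
    by rewrite mulr_ge0 ?invr_ge0 ?exprn_ge0 ?(ltW rho0).
  rewrite /ellipse_weight.
  by move: (rho ^+ j)^-1 (rho ^+ j) (rho ^+ m.+2)^-1 h h' => x y z; nra.
move/le_trans; apply; rewrite /cheb_bound le_eqVlt; apply/orP; left.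
by apply/eqP; field; rewrite pnatr_eq0 -lt0n fact_gt0 expf_neq0 ?gt_eqF.
Qed.

End phi_error.

(** * The error bounds *)

Section error_bounds.
Variables (R : realType) (N : nat) (A : 'M[R[i]]_N) (b : 'cV[R[i]]_N).
Variables (p : nat).
Local Notation a := (norm_inf A).
Hypothesis a_gt0 : 0 < a.

Let c_gt0 : 0 < 1 + Num.sqrt 2 :> R.
Proof. by rewrite ltr_wpDr ?sqrtr_ge0. Qed.

Lemma clenshaw_curtis_error_even n : (4 <= n)%N -> ~~ odd n ->
  (1 + Num.sqrt 2) / 2 * a + p%:R <= n%:R ->
  norm_inf (phi p.+1 A *m b
            - phi_quadrature (@clenshaw_curtis_nodes R n) p A b)
  <= quadrature_bound a (norm_inf b) p n.
Proof.
move=> n4 en an; have n0 : (0 < n)%N by lia.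
have pn : (p <= n)%N.
  by rewrite -(ler_nat R) (le_trans _ an)// lerDr mulr_ge0 ?divr_ge0// ltW.
have [|rho rho1] := cheb_bound_le_exact p a_gt0 (norm_inf_ge0 b) (r := n - p).
  by rewrite natrB// lerBrDr.
rewrite subnKC//; apply: le_trans.
apply: phi_quadrature_error_cheb => // [j jn|j]; last first.
  exact: clenshaw_curtis_chebT_le.
have [jn1|jn1] := leqP j n; first exact: clenshaw_curtis_chebT_exact.
by have -> : j = n.+1 by [lia]; exact: clenshaw_curtis_chebT_even.
Qed.

(** For odd [n] the rule is exact only up to degree [n]; with [m = n - 1] this
    is again [m + 1], but the hypothesis on [n] is then one short. *)
Lemma clenshaw_curtis_error_odd n : (4 <= n)%N -> odd n ->
  (1 + Num.sqrt 2) / 2 * a + p%:R <= n%:R ->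
  norm_inf (phi p.+1 A *m b
            - phi_quadrature (@clenshaw_curtis_nodes R n) p A b)
  <= quadrature_bound a (norm_inf b) p n.-1.
Proof.
move=> n4 on an; have n0 : (0 < n)%N by lia.
have n5 : (4 <= n.-1)%N by lia.
have pn : (p < n)%N.
  by rewrite -(ltr_nat R) (lt_le_trans _ an)// ltrDr mulr_gt0 ?divr_gt0.
have rE : (p + (n.-1 - p) = n.-1)%N by lia.
have [||rho rho1] := cheb_bound_le_offby1 (p := p) (r := n.-1 - p) a_gt0
  (norm_inf_ge0 b).
- by rewrite rE.
- have -> : ((n.-1 - p).+1 = n - p)%N by lia.
  by rewrite natrB ?(ltnW pn)// lerBrDr.
rewrite rE; apply: le_trans.
apply: phi_quadrature_error_cheb => // [j jn|j]; last first.
  exact: clenshaw_curtis_chebT_le.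
by apply: clenshaw_curtis_chebT_exact => //; lia.
Qed.

Lemma gauss_legendre_error n (s : 'I_n.+1 -> R) : gauss_legendre_nodes s ->
  (2 <= n)%N -> (1 + Num.sqrt 2) / 4 * a + p%:R / 2 <= n%:R ->
  norm_inf (phi p.+1 A *m b - phi_quadrature s p A b)
  <= quadrature_bound a (norm_inf b) p (2 * n).
Proof.
move=> s_nodes n2 an; have an2 : (1 + Num.sqrt 2) / 2 * a + p%:R <= (2 * n)%:R.
  rewrite natrM -ler_pdivrMl//; apply: le_trans an.
  by rewrite le_eqVlt; apply/orP; left; apply/eqP; field.
have pn : (p <= 2 * n)%N.
  by rewrite -(ler_nat R) (le_trans _ an2)// lerDr mulr_ge0 ?divr_ge0// ltW.
have [|rho rho1] := cheb_bound_le_exact p (r := 2 * n - p) a_gt0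
  (norm_inf_ge0 b).
  by rewrite natrB// lerBrDr.
rewrite subnKC//; apply: le_trans.
apply: phi_quadrature_error_cheb => // [|j jn|j]; first by lia.
  by apply: gauss_quad_err_exact => //; apply: leq_trans (size_chebT R j) _;
    lia.
exact: gauss_chebT_le.
Qed.

End error_bounds.

Theorem corollary3p3 (R : realType) (N : nat) (A : 'M[R[i]]_N)
    (b : 'cV[R[i]]_N) (p n : nat)
    (hA0 : A != 0) (hA : kronecker_sum A) :
  (Num.max 4%:Z
     (Num.ceil ((1 + Num.sqrt 2) / 2 * norm_inf A + p%:R)) <= n%:Z ->
   (~~ odd n ->
    norm_inf (phi p.+1 A *m b
              - phi_quadrature (@clenshaw_curtis_nodes R n) p A b)
    <= quadrature_bound (norm_inf A) (norm_inf b) p n) /\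
   (odd n ->
    norm_inf (phi p.+1 A *m b
              - phi_quadrature (@clenshaw_curtis_nodes R n) p A b)
    <= quadrature_bound (norm_inf A) (norm_inf b) p n.-1)) /\
  (forall s : 'I_n.+1 -> R, gauss_legendre_nodes s ->
   Num.max 2%:Z
     (Num.ceil ((1 + Num.sqrt 2) / 4 * norm_inf A + p%:R / 2)) <= n%:Z ->
   norm_inf (phi p.+1 A *m b - phi_quadrature s p A b)
   <= quadrature_bound (norm_inf A) (norm_inf b) p (2 * n)).
Proof.
have a0 : 0 < norm_inf A.
  by rewrite ltNge; apply: contra hA0 => /norm_inf_eq0 ->.
split=> [|s s_nodes];
  rewrite ge_max ceil_le_int lez_nat -pmulrn => /andP[nk an].
  by split=> on;
    [apply: clenshaw_curtis_error_even|apply: clenshaw_curtis_error_odd].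
exact: gauss_legendre_error.
Qed.
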